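(* Consider the downlink of a multi-RIS multi-user MIMO system in which a base station (BS) with $M$ antennas serves $U_d$ direct users and $K$ blocked users, the $k$-th blocked user being served only through the $k$-th reconfigurable intelligent surface (RIS), which has $N$ elements. Let $\mathbf{H}_k\in\mathbb{C}^{M\times N}$ be the BS–RIS-$k$ channel, $\mathbf{h}_{k,1}=(h_{k,1},\dots,h_{k,N})^T\in\mathbb{C}^N$ the RIS-$k$–user channel (so $h_{k,i}$ is its $i$-th entry), and $\mathbf{h}_{d,u}\in\mathbb{C}^M$ the BS–direct-user-$u$ channel, all with complex normal entries, $\mathbb{E}\{\mathbf{H}_k^H\mathbf{H}_k\}=\mathbf{R}_k$ (invertible) and $\mathbb{E}\{\mathbf{H}_k^H\mathbf{H}_{k'}\}=\mathbf{0}$ for $k\ne k'$. Let $\mathbf{Q}_2=[\mathbf{H}_1\ \cdots\ \mathbf{H}_K\ \mathbf{h}_{d,1}\ \cdots\ \mathbf{h}_{d,U_d}]^H\in\mathbb{C}^{(NK+U_d)\times M}$ and let $\boldsymbol{\Gamma}\in\mathbb{R}^{(NK+U_d)\times(K+U_d)}$ be the matrix whose $k$-th column ($k\le K$) has ones in rows $(k-1)N+1,\dots,kN$ and zeros elsewhere, and whose last $U_d$ columns are $\begin{bmatrix}\mathbf{0}_{NK\times U_d}\\ \mathbf{I}_{U_d}\end{bmatrix}$. Use the beamforming matrix $\mathbf{W}'_{\mathrm{ZF}}=\mathbf{Q}_2^H(\mathbf{Q}_2\mathbf{Q}_2^H)^{-1}\boldsymbol{\Gamma}$, so that the SINR of the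 blocked user of RIS $k$ with phase shifts $\phi_{k,1},\dots,\phi_{k,N}$ is $$\mathrm{SINR}_{b,k,1}=\frac{\Big|\sum_{i=1}^{N}e^{j\phi_{k,i}}h_{k,i}^{*}\big[\mathbf{H}_k^H\mathbf{Q}_2^H(\mathbf{Q}_2\mathbf{Q}_2^H)^{-1}\boldsymbol{\Gamma}\mathbf{e}_k\big]_i\Big|^2}{\sigma_k^2}.$$ Then, as $M\to\infty$, the phase shifts of the $k$-th RIS that maximize this SINR are $$\phi_{k,i}=-\sphericalangle\big(h_{k,i}^{*}f_{k,i}\big),\qquad i=1,\dots,N,$$ and the maximum SINR is $$\mathrm{SINR}^{*}_{b,k,1}=\frac{1}{\sigma_k^2}\Big(\sum_{i=1}^{N}|f_{k,i}|\,|h_{k,i}|\Big)^2,$$ where $f_{k,i}$ is the $i$-th entry of $$\mathbf{f}_k=\begin{bmatrix}\mathbf{0}_{N\times(k-1)N} & \mathbf{R}_k & \mathbf{0}_{N\times((K-k)N+U_d)}\end{bmatrix}\,\mathrm{blkdiag}\big(\mathbf{R}_1^{-1},\dots,\mathbf{R}_K^{-1},\mathbf{I}_{U_d}\big)\,\boldsymbol{\Gamma}\,\mathbf{e}_k.$$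
   Context: $\mathbf{e}_k$ is the $k$-th standard unit vector of $\mathbb{R}^{K+U_d}$, $\sigma_k^2>0$ is the noise power at the user, $\sphericalangle(z)$ denotes the argument of a complex number $z$, $^*$ complex conjugation, $^H$ conjugate transpose, and $\mathrm{blkdiag}(\cdot)$ the block-diagonal matrix formed from its arguments. The beamformer requires $M>NK+U_d$. The asymptotic regime $M\to\infty$ refers to the limit in which inner products of BS-side channel columns converge to their expectations, i.e. $\mathbf{H}_k^H\mathbf{H}_n\to\mathbf{R}_k$ if $n=k$ and $\to\mathbf{0}$ if $n\ne k$. *)

(* Defs.v *)
From mathcomp Require Import all_boot all_order all_algebra.
From mathcomp Require Import reals trigo complex.
Set Implicit Arguments. Unset Strict Implicit. Unset Printing Implicit Defensive.
Import Order.TTheory GRing.Theory Num.Theory.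
Local Open Scope ring_scope.

Definition herm (C : pzRingType) m n (A : 'M[C[i]]_(m, n)) : 'M[C[i]]_(n, m) :=
  (map_mx (@conjc C) A)^T.

Definition expj (R : realType) (t : R) : R[i] := Complex (cos t) (sin t).

(* argument of a complex number (atan2 convention, value in (-pi, pi]; 0 at 0) *)
Definition carg (R : realType) (z : R[i]) : R :=
  let a := complex.Re z in let b := complex.Im z in
  if 0 < a then atan (b / a)
  else if a < 0 then (if 0 <= b then atan (b / a) + pi else atan (b / a) - pi)
  else if 0 < b then pi / 2 else if b < 0 then - (pi / 2) else 0.

(* block index decomposition of 'I_(K*N): a = blk a * N + elt a *)
Lemma blk_lt K N (a : 'I_(K * N)) : (a %/ N < K)%N.
Proof.
case: a => a /=; case: N => [|N]; first by rewrite muln0.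
by move=> Ha; rewrite ltn_divLR.
Qed.
Lemma elt_lt K N (a : 'I_(K * N)) : (a %% N < N)%N.
Proof.
case: a => a /=; case: N => [|N]; first by rewrite muln0.
by move=> _; rewrite ltn_pmod.
Qed.
Definition blk K N (a : 'I_(K * N)) : 'I_K := Ordinal (blk_lt a).
Definition elt K N (a : 'I_(K * N)) : 'I_N := Ordinal (elt_lt a).

Section Model.
Variables (R : realType) (M N K Ud : nat).
Local Notation C := R[i].

Definition Q2H (H : 'I_K -> 'M[C]_(M, N)) (hd : 'I_Ud -> 'cV[C]_M)
  : 'M[C]_(M, K * N + Ud) :=
  \matrix_(r < M, j < K * N + Ud)
    match split j with
    | inl a => H (blk a) r (elt a)
    | inr u => hd u r ord0
    end.

Definition Q2 H hd : 'M[C]_(K * N + Ud, M) := herm (Q2H H hd).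

(* Gamma in R^{(NK+Ud) x (K+Ud)} (embedded in C) *)
Definition Gamma : 'M[C]_(K * N + Ud, K + Ud) :=
  \matrix_(j, c)
    match split j, split c with
    | inl a, inl k => ((blk a == k) : nat)%:R
    | inr u, inr v => ((u == v) : nat)%:R
    | _, _ => 0
    end.

Definition ek (k : 'I_K) : 'cV[C]_(K + Ud) := delta_mx (lshift Ud k) ord0.

Definition blkdiag_inv (Rm : 'I_K -> 'M[C]_N) : 'M[C]_(K * N + Ud) :=
  \matrix_(j, j')
    match split j, split j' with
    | inl a, inl b => if blk a == blk b then invmx (Rm (blk a)) (elt a) (elt b) else 0
    | inr u, inr v => ((u == v) : nat)%:R
    | _, _ => 0
    end.

(* [0_{N x (k-1)N}  R_k  0_{N x ((K-k)N+Ud)}] *)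
Definition selR (Rm : 'I_K -> 'M[C]_N) (k : 'I_K) : 'M[C]_(N, K * N + Ud) :=
  \matrix_(i, j)
    match split j with
    | inl a => if blk a == k then Rm k i (elt a) else 0
    | inr _ => 0
    end.

Definition fvec (Rm : 'I_K -> 'M[C]_N) (k : 'I_K) : 'cV[C]_N :=
  selR Rm k *m blkdiag_inv Rm *m Gamma *m ek k.

Definition zf_vec H hd (k : 'I_K) : 'cV[C]_N :=
  herm (H k) *m Q2H H hd *m invmx (Q2 H hd *m Q2H H hd) *m Gamma *m ek k.

Definition sinr H hd (h1 : 'cV[C]_N) (sigma2 : R) (k : 'I_K) (phi : 'I_N -> R) : R :=
  (Normc.normc (\sum_(i < N) expj (phi i) * conjc (h1 i ord0) * zf_vec H hd k i ord0)) ^+ 2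
  / sigma2.

End Model.

(* Main.v *)
Require Import Defs.
From mathcomp Require Import all_boot all_order all_algebra.
From mathcomp Require Import reals trigo complex.
From mathcomp Require Import ring lra.
Import Order.TTheory GRing.Theory Num.Theory.
Local Open Scope ring_scope.

(* H_k^H is the k-th block of N rows of Q_2, so Q_2^H (Q_2 Q_2^H)^-1 cancels
   against it and the effective channel H_k^H W'_ZF e_k is exactly the block
   of ones in column k of Gamma; likewise f_k = R_k R_k^-1 1 = 1.  Neither
   step needs the asymptotic hypothesis.  The SINR is then
   |sum_i e^{j phi_i} h_i^*|^2 / sigma^2, which the triangle inequality bounds
   by (sum_i |h_i|)^2, with equality when every term is rotated onto the
   nonnegative real axis, i.e. phi_i = - arg h_i^*. *)

Lemma split_lshift m n (a : 'I_m) : split (lshift n a) = inl a.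
Proof. exact: (unsplitK (inl a)). Qed.

Section BlockIndex.
Variables K N Ud : nat.

Lemma block_ord_lt (k : 'I_K) (i : 'I_N) : (k * N + i < K * N)%N.
Proof.
apply: (@leq_trans (k.+1 * N)); last by rewrite leq_mul2r ltn_ord orbT.
by rewrite mulSnr ltn_add2l.
Qed.

Definition block_ord (k : 'I_K) (i : 'I_N) : 'I_(K * N) := Ordinal (block_ord_lt k i).

Definition block_idx (k : 'I_K) (i : 'I_N) : 'I_(K * N + Ud) := lshift Ud (block_ord k i).

Lemma blk_block_ord k i : blk (block_ord k i) = k.
Proof.
apply: val_inj => /=; have N_gt0 : (0 < N)%N by apply: leq_ltn_trans (ltn_ord i).
by rewrite divnMDl // divn_small // addn0.
Qed.

Lemma elt_block_ord k i : elt (block_ord k i) = i.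
Proof. by apply: val_inj => /=; rewrite modnMDl modn_small. Qed.

Lemma eq_lshift_block_idx (a : 'I_(K * N)) k i :
  (lshift Ud a == block_idx k i) = (blk a == k) && (elt a == i).
Proof.
rewrite eq_lshift; apply/eqP/andP => [->|[/eqP <- /eqP <-]].
  by rewrite blk_block_ord elt_block_ord.
by apply: val_inj; rewrite /= -divn_eq.
Qed.

Lemma block_idx_inj k : injective (block_idx k).
Proof.
move=> i i' /eqP; rewrite eq_lshift_block_idx blk_block_ord elt_block_ord.
by case/andP=> _ /eqP.
Qed.

Variable C : pzRingType.

Definition blksel (k : 'I_K) : 'M[C]_(N, K * N + Ud) :=
  \matrix_(i, j) (j == block_idx k i)%:R.

Lemma mul_blksel k p (X : 'M[C]_(K * N + Ud, p)) i c :
  (blksel k *m X) i c = X (block_idx k i) c.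
Proof.
rewrite mxE (bigD1 (block_idx k i)) //= mxE eqxx mul1r big1 ?addr0 // => j /negbTE ne.
by rewrite mxE ne mul0r.
Qed.

Lemma mul_blksel_tr k p (X : 'M[C]_(p, K * N + Ud)) r i :
  (X *m (blksel k)^T) r i = X r (block_idx k i).
Proof.
rewrite mxE (bigD1 (block_idx k i)) //= !mxE eqxx mulr1 big1 ?addr0 // => j /negbTE ne.
by rewrite !mxE ne mulr0.
Qed.

Lemma mul_mx_blksel k p (X : 'M[C]_(p, N)) r j :
  (X *m blksel k) r j =
  match split j with inl a => if blk a == k then X r (elt a) else 0 | inr _ => 0 end.
Proof.
rewrite mxE; under eq_bigr do rewrite mxE.
case: splitP => [a j_a | u j_u]; last first.
  have -> : j = rshift (K * N) u by exact: val_inj.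
  by rewrite big1 // => i _; rewrite eq_rlshift mulr0.
have -> : j = lshift Ud a by exact: val_inj.
have [<-|blk_a] := eqVneq (blk a) k; last first.
  by rewrite big1 // => i _; rewrite eq_lshift_block_idx (negbTE blk_a) mulr0.
rewrite (bigD1 (elt a)) //= eq_lshift_block_idx !eqxx mulr1 big1 ?addr0 // => i ne_i.
by rewrite eq_lshift_block_idx eqxx eq_sym (negbTE ne_i) mulr0.
Qed.

Lemma blksel_mul_tr k : blksel k *m (blksel k)^T = 1%:M.
Proof.
apply/matrixP => i i'; rewrite mul_blksel_tr !mxE.
by rewrite (inj_eq (@block_idx_inj k)) eq_sym.
Qed.

End BlockIndex.

Arguments block_ord {K N}.
Arguments block_idx {K N} Ud.
Arguments blksel {K N} Ud {C}.

Section ZeroForcing.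
Variables (R : realType) (M N K Ud : nat) (k : 'I_K).
Local Notation C := R[i].

Lemma herm_blksel (H : 'I_K -> 'M[C]_(M, N)) (hd : 'I_Ud -> 'cV[C]_M) :
  herm (H k) = blksel Ud k *m Q2 H hd.
Proof.
apply/matrixP => i r; rewrite mul_blksel /Q2 /herm !mxE /block_idx split_lshift.
by rewrite blk_block_ord elt_block_ord.
Qed.

Lemma Gamma_ek : Gamma R N K Ud *m ek R Ud k = (blksel Ud k)^T *m const_mx 1.
Proof.
rewrite -[RHS]trmxK trmx_mul trmxK; apply/matrixP => j c.
rewrite [RHS]mxE mul_mx_blksel /ek -colE !mxE split_lshift.
by case: (split j) => // a; case: (blk a == k); rewrite ?mxE.
Qed.

Lemma selR_blksel (Rm : 'I_K -> 'M[C]_N) : selR Ud Rm k = Rm k *m blksel Ud k.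
Proof. by apply/matrixP => i j; rewrite mul_mx_blksel mxE. Qed.

Lemma blksel_blkdiag_inv (Rm : 'I_K -> 'M[C]_N) :
  blksel Ud k *m blkdiag_inv Ud Rm *m (blksel Ud k)^T = invmx (Rm k).
Proof.
apply/matrixP => i i'; rewrite mul_blksel_tr mul_blksel mxE /block_idx !split_lshift.
by rewrite !blk_block_ord eqxx !elt_block_ord.
Qed.

Lemma zf_vec_ones (H : 'I_K -> 'M[C]_(M, N)) (hd : 'I_Ud -> 'cV[C]_M) :
  Q2 H hd *m Q2H H hd \in unitmx -> zf_vec H hd k = const_mx 1.
Proof.
move=> Gram_unit; rewrite /zf_vec (herm_blksel H hd) -(mulmxA (blksel _ _)) mulmxK //.
by rewrite -mulmxA Gamma_ek mulmxA blksel_mul_tr mul1mx.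
Qed.

Lemma fvec_ones (Rm : 'I_K -> 'M[C]_N) :
  Rm k \in unitmx -> fvec Ud Rm k = const_mx 1.
Proof.
move=> Rk_unit; rewrite /fvec -mulmxA Gamma_ek selR_blksel !mulmxA.
by rewrite -(mulmxA (Rm k)) -(mulmxA (Rm k)) blksel_blkdiag_inv mulmxV // mul1mx.
Qed.

End ZeroForcing.

Section ComplexNorm.
Variable R : rcfType.
Import Normc.
Local Open Scope complex_scope.

Lemma normc_ge0 (z : R[i]) : 0 <= normc z.
Proof. by case: z => a b; rewrite sqrtr_ge0. Qed.

Lemma normc_real (x : R) : 0 <= x -> normc x%:C = x.
Proof. by move=> x_ge0; rewrite /= expr0n addr0 sqrtr_sqr ger0_norm. Qed.

Lemma normc_conj (z : R[i]) : normc z^*%C = normc z.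
Proof. by case: z => a b; rewrite /= sqrrN. Qed.

Lemma normc_sum_le (I : finType) (F : I -> R[i]) :
  normc (\sum_i F i) <= \sum_i normc (F i).
Proof.
elim/big_rec2: _ => [|i y x _ IH]; first by rewrite normc0.
by apply: le_trans (le_normcD _ _) _; rewrite lerD2l.
Qed.

Lemma normc_unit_sum_le (I : finType) (u z : I -> R[i]) :
  (forall i, normc (u i) = 1) -> normc (\sum_i u i * z i) <= \sum_i normc (z i).
Proof.
move=> u_unit; apply: le_trans (normc_sum_le _ _) _.
by under eq_bigr do rewrite normcM u_unit mul1r.
Qed.

Lemma normc_aligned_sum (I : finType) (u z : I -> R[i]) :
  (forall i, u i * z i = (normc (z i))%:C) ->
  normc (\sum_i u i * z i) = \sum_i normc (z i).
Proof.
move=> aligned; under eq_bigr do rewrite aligned.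
by rewrite -rmorph_sum normc_real // sumr_ge0 // => i _; exact: normc_ge0.
Qed.

End ComplexNorm.

Section Phase.
Variable R : realType.
Import Normc.
Local Open Scope complex_scope.

Lemma normc_expj (t : R) : normc (expj t) = 1.
Proof. by rewrite /= cos2Dsin2 sqrtr1. Qed.

Lemma expjDpi (t : R) : expj (t + pi) = - expj t.
Proof. by rewrite /expj cosDpi sinDpi. Qed.

Lemma expjBpi (t : R) : expj (t - pi) = - expj t.
Proof. by rewrite -[in RHS](subrK pi t) expjDpi opprK. Qed.

Lemma cos_atan_gt0 (x : R) : 0 < cos (atan x).
Proof. by rewrite cos_atan invr_gt0 sqrtr_gt0; nra. Qed.

Lemma expjN_atan_mul (a b : R) : a != 0 ->
  expj (- atan (b / a)) * (a +i* b) = (a * (cos (atan (b / a)) * (1 + (b / a) ^+ 2)))%:C.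
Proof.
move=> a_neq0; set t := b / a.
have b_eq : b = t * a by rewrite divfK.
have s_eq : sin (atan t) = t * cos (atan t).
  by rewrite -{2}(atanK t) /tan divfK // gt_eqF ?cos_atan_gt0.
rewrite /expj cosN sinN s_eq; apply/eqP; rewrite eq_complex /= b_eq.
by apply/andP; split; apply/eqP; ring.
Qed.

Lemma expjN_carg_ge0 (z : R[i]) : 0 <= expj (- carg z) * z.
Proof.
have factor_gt0 (t : R) : 0 < cos (atan t) * (1 + t ^+ 2).
  by rewrite mulr_gt0 ?cos_atan_gt0 // ltr_wpDr ?sqr_ge0.
case: z => a b; rewrite /carg /=.
have [a_gt0|a_le0] := ltP 0 a.
  by rewrite expjN_atan_mul ?gt_eqF // ler0c mulr_ge0 ?ltW.
have [a_lt0|a_ge0] := ltP a 0.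
  case: ifP => _; rewrite opprD ?opprK ?expjBpi ?expjDpi mulNr expjN_atan_mul ?lt_eqF //;
  by rewrite -rmorphN ler0c -mulNr mulr_ge0 ?oppr_ge0 ?ltW.
have -> : a = 0 by apply/eqP; rewrite eq_le a_le0 a_ge0.
case: ltgtP => [b_gt0|b_lt0|<-]; rewrite lecE /expj /= ?cosN ?sinN;
  rewrite ?cos_pihalf ?sin_pihalf ?cos0 ?sin0; by apply/andP; split; first apply/eqP; lra.
Qed.

Lemma expjN_carg_mul (z : R[i]) : expj (- carg z) * z = (normc z)%:C.
Proof.
rewrite -[LHS](ger0_norm (expjN_carg_ge0 z)).
have -> : `|expj (- carg z) * z| = (normc (expj (- carg z) * z))%:C by [].
by rewrite normcM normc_expj mul1r.
Qed.

End Phase.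

Import Normc.

Theorem proposition2 (R : realType) (M N K Ud : nat)
    (H : 'I_K -> 'M[R[i]]_(M, N)) (hd : 'I_Ud -> 'cV[R[i]]_M)
    (h1 : 'I_K -> 'cV[R[i]]_N) (Rm : 'I_K -> 'M[R[i]]_N)
    (sigma2 : 'I_K -> R) (k : 'I_K) :
  (K * N + Ud < M)%N ->
  (forall l, Rm l \in unitmx) ->
  (forall l, 0 < sigma2 l) ->
  (* asymptotic regime M -> oo: H_l^H H_n -> R_l if n = l, 0 otherwise *)
  (forall l n : 'I_K, herm (H l) *m H n = if n == l then Rm l else 0) ->
  Q2 H hd *m Q2H H hd \in unitmx ->
  let f := fvec Ud Rm k in
  let SINR := sinr H hd (h1 k) (sigma2 k) k in
  let phistar := fun i : 'I_N => - carg (complex.conjc (h1 k i ord0) * f i ord0) in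
  (forall phi : 'I_N -> R, SINR phi <= SINR phistar) /\
  SINR phistar =
    (\sum_(i < N) Normc.normc (f i ord0) * Normc.normc (h1 k i ord0)) ^+ 2 / sigma2 k.
Proof.
move=> _ Rm_unit sigma2_gt0 _ Gram_unit f SINR phistar.
have f_ones : f = const_mx 1 by exact: fvec_ones.
pose g i := conjc (h1 k i ord0).
have SINRE phi : SINR phi = normc (\sum_i expj (phi i) * g i) ^+ 2 / sigma2 k.
  by rewrite /SINR /sinr zf_vec_ones //; under eq_bigr do rewrite mxE mulr1.
have phistar_opt : normc (\sum_i expj (phistar i) * g i) = \sum_i normc (h1 k i ord0).
  rewrite /phistar f_ones; under eq_bigr do rewrite mxE mulr1.
  rewrite normc_aligned_sum => [|i]; last exact: expjN_carg_mul.
  by under eq_bigr do rewrite normc_conj.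
split=> [phi|]; rewrite !SINRE phistar_opt; last first.
  by rewrite f_ones; under [in RHS]eq_bigr do rewrite mxE normc1 mul1r.
apply: ler_wpM2r; first by rewrite invr_ge0 ltW.
have sum_ge0 : 0 <= \sum_i normc (h1 k i ord0).
  by apply: sumr_ge0 => i _; exact: normc_ge0.
apply: lerXn2r; rewrite ?nnegrE ?normc_ge0 //.
under [X in _ <= X]eq_bigr do rewrite -normc_conj.
by apply: normc_unit_sum_le => i; exact: normc_expj.
Qed.
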